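(* Let $n<\omega$. (i) Every $A\in\mathcal{F}^\nabla_n$ is $\mathrm{RC}^\nabla$-equivalent to a formula in fat normal form. (ii) The words in the fat normal form of $A$ are unique modulo equivalence in $\mathrm{RC}$: if $\nabla_nA_n\land\dots\land\nabla_{n+k}A_{n+k}$ and $\nabla_nB_n\land\dots\land\nabla_{n+m}B_{n+m}$ are both in fat normal form and both $\mathrm{RC}^\nabla$-equivalent to $A$, then $k=m$ and $A_i$ and $B_i$ are equivalent for every $i=n,\dots,n+k$.
   Context: Strictly positive formulas are built from propositional variables and $\top$ by $\land$ and unary modalities $\Diamond_n,\nabla_n$ ($n<\omega$). $\mathcal{F}^\nabla_n$ is the set of variable-free strictly positive formulas using only modalities $\Diamond_i,\nabla_i$ with $i\ge n$. A word is a formula $\Diamond_{j_1}\cdots\Diamond_{j_r}\top$; $\mathcal{W}_i$ is the set of words with all $j_s\ge i$. $\mathrm{RC}^\nabla$ is the smallest set of sequents $A\vdash B$ containing the following axioms and closed under the following rules and under substitution: (1) $A\vdash A$; $A\vdash\top$; $A\land B\vdash A$; $A\land B\vdash B$; from $A\vdash B$, $B\vdash C$ infer $A\vdash C$; from $A\vdash B$, $A\vdash C$ infer $A\vdash B\land C$; from $A\vdash B$ infer $aA\vdash aB$ for each modality $a$; (2) $aaA\vdash aA$ for each modality $a$; (3) for $m<n$: $\Diamond_nA\vdash\Diamond_mA$, $\Diamond_nA\land\Diamond_mB\vdash\Diamond_n(A\land\Diamond_mB)$, and the same two with $\nabla$ in place of $\Diamond$; (4) $A\vdash\nabla_nA$,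 $\Diamond_nA\vdash\nabla_nA$; (5) for $m\le n$: $\Diamond_m\nabla_nA\vdash\Diamond_mA$, $\nabla_n\Diamond_mA\vdash\Diamond_mA$. $\mathrm{RC}$ is the analogous system in the signature $\{\Diamond_n\}$ only (axioms/rules (1)–(3) for $\Diamond$). A formula $A\in\mathcal{F}^\nabla_n$ is in fat normal form if either $A$ is literally $\top$, or $A$ is $\nabla_nA_n\land\nabla_{n+1}A_{n+1}\land\dots\land\nabla_{n+k}A_{n+k}$ where $A_i\in\mathcal{W}_i$ for all $i$, $A_{n+k}$ is not the word $\top$, and for all $i=n,\dots,n+k$, $\nabla_iA_i\vdash\nabla_i(\nabla_iA_i\land\dots\land\nabla_{n+k}A_{n+k})$ is provable in $\mathrm{RC}^\nabla$. *)

(* Defs.v *)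
From mathcomp Require Import all_boot.

Set Implicit Arguments.
Unset Strict Implicit.
Unset Printing Implicit Defensive.

(* Strictly positive formulas whose unary modalities are indexed by M. *)
Inductive form (M : Type) : Type :=
| Var (p : nat)
| Top
| And (A B : form M)
| Mod (a : M) (A : form M).

Arguments Var {M} p.
Arguments Top {M}.

Fixpoint subst M (s : nat -> form M) (A : form M) : form M :=
  match A with
  | Var p => s p
  | Top => Top
  | And A B => And (subst s A) (subst s B)
  | Mod a A => Mod a (subst s A)
  end.

(* The least set of sequents A |- B that contains Ax, the axioms of strictly
   positive logic and transitivity for every modality in M, and is closed under
   the rules and under substitution. *)
Inductive derivable M (Ax : form M -> form M -> Prop) :
  form M -> form M -> Prop :=
| d_ax A B : Ax A B -> derivable Ax A B
| d_refl A : derivable Ax A A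
| d_top A : derivable Ax A Top
| d_andl A B : derivable Ax (And A B) A
| d_andr A B : derivable Ax (And A B) B
| d_cut A B C : derivable Ax A B -> derivable Ax B C -> derivable Ax A C
| d_and A B C : derivable Ax A B -> derivable Ax A C -> derivable Ax A (And B C)
| d_mod a A B : derivable Ax A B -> derivable Ax (Mod a A) (Mod a B)
| d_trans a A : derivable Ax (Mod a (Mod a A)) (Mod a A)
| d_subst s A B : derivable Ax A B -> derivable Ax (subst s A) (subst s B).

Inductive family_ax M (f : nat -> M) : form M -> form M -> Prop :=
| fam_mono m n A : m < n -> family_ax f (Mod (f n) A) (Mod (f m) A)
| fam_J m n A B : m < n ->
    family_ax f (And (Mod (f n) A) (Mod (f m) B))
                (Mod (f n) (And A (Mod (f m) B))).

Inductive modality : Type := Dia of nat | Nab of nat.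

Definition modality_index (a : modality) : nat :=
  match a with Dia i => i | Nab i => i end.

Inductive RCN_ax : form modality -> form modality -> Prop :=
| RCN_dia A B : family_ax Dia A B -> RCN_ax A B
| RCN_nab A B : family_ax Nab A B -> RCN_ax A B
| RCN_unit n A : RCN_ax A (Mod (Nab n) A)
| RCN_dia_nab n A : RCN_ax (Mod (Dia n) A) (Mod (Nab n) A)
| RCN_absorbl m n A : m <= n ->
    RCN_ax (Mod (Dia m) (Mod (Nab n) A)) (Mod (Dia m) A)
| RCN_absorbr m n A : m <= n ->
    RCN_ax (Mod (Nab n) (Mod (Dia m) A)) (Mod (Dia m) A).

Definition RCN : form modality -> form modality -> Prop := derivable RCN_ax.

Definition RCN_equiv (A B : form modality) : Prop := RCN A B /\ RCN B A.

(* In the language of RC the modality <n> is represented by n itself. *)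
Definition RC : form nat -> form nat -> Prop := derivable (family_ax id).

Definition RC_equiv (A B : form nat) : Prop := RC A B /\ RC B A.

(* The word <j_1>...<j_r>T is encoded by the sequence [:: j_1; ...; j_r]; the
   parameter f names the diamonds in the language where the word is read:
   Dia for RC^nabla and id for RC. *)
Definition word M (f : nat -> M) (w : seq nat) : form M :=
  foldr (fun j => Mod (f j)) Top w.

Definition in_W (i : nat) (w : seq nat) : bool := all (fun j => i <= j) w.

Fixpoint in_F (n : nat) (A : form modality) : bool :=
  match A with
  | Var _ => false
  | Top => true
  | And A B => in_F n A && in_F n B
  | Mod a A => (n <= modality_index a) && in_F n A
  end.

(* The conjunction of nabla_i A_i over n <= i <= n + k, nested to the right;
   A is only read at these k + 1 indices. *)
Fixpoint nabla_conj (n k : nat) (A : nat -> seq nat) : form modality :=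
  match k with
  | 0 => Mod (Nab n) (word Dia (A n))
  | k'.+1 => And (Mod (Nab n) (word Dia (A n))) (nabla_conj n.+1 k' A)
  end.

Definition fat_conditions (n k : nat) (A : nat -> seq nat) : Prop :=
  [/\ forall i, n <= i <= n + k -> in_W i (A i),
      A (n + k) <> [::]
    & forall i, n <= i <= n + k ->
        RCN (Mod (Nab i) (word Dia (A i)))
            (Mod (Nab i) (nabla_conj i (n + k - i) A))].

Definition fat_normal_form (n : nat) (F : form modality) : Prop :=
  in_F n F /\
  (F = Top \/ exists k A, F = nabla_conj n k A /\ fat_conditions n k A).

(* Main.v *)
Require Import Defs.
From mathcomp Require Import all_boot.

(** Existence: by linearity of the order [u < v iff v |- <n>u] on words of W_n,
    nabla_n (nabla_n u /\ nabla_{n+1} v) is equivalent to nabla_n of a word, so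
    every formula is equivalent to a conjunction of nabla_i A_i, and A_i can be
    replaced by the word of nabla_i (nabla_i A_i /\ ... /\ nabla_{n+k} A_{n+k}).

    Uniqueness: replacing every subformula whose modality has index below i by T
    preserves derivability, so by fatness equivalent normal forms have
    equivalent components nabla_i A_i and nabla_i B_i.  By linearity it remains
    to see that no word w derives <i>w in RC^nabla.  This holds in a model made
    of sequences of (notations for) ordinals in which a_{i+1} is at most the
    last exponent of a_i: there <n>X consists of the sequences that exceed a
    member of X strictly in the components 0, ..., n, and a word denotes the set
    of valid sequences above a least one.  A Kripke model could not do: every
    RC^nabla-frame validates <1>T |- <0><1>T. *)

Set Implicit Arguments.
Unset Strict Implicit.
Unset Printing Implicit Defensive.

(** * Derived rules of strictly positive logic *)

Section StrictlyPositive.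

Variables (M : Type) (Ax : form M -> form M -> Prop).
Local Notation "A |- B" := (derivable Ax A B) (at level 70).

Lemma d_and_l A B C : A |- C -> And A B |- C.
Proof. exact/d_cut/d_andl. Qed.

Lemma d_and_r A B C : B |- C -> And A B |- C.
Proof. exact/d_cut/d_andr. Qed.

Lemma d_and_mono A A' B B' : A |- A' -> B |- B' -> And A B |- And A' B'.
Proof. by move=> hA hB; apply: d_and; [apply: d_and_l | apply: d_and_r]. Qed.

Lemma d_mod_absorb a A B : A |- Mod a B -> Mod a A |- Mod a B.
Proof. by move=> h; apply: d_cut (d_trans Ax a B); apply: d_mod. Qed.

End StrictlyPositive.

(** * A model of RC^nabla *)

(* [Node x r] is the list with head [x] and tail [r]; on hereditarily
   decreasing lists, [tlt] is the order of Cantor normal forms below epsilon_0.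
   Well-foundedness plays no role, so arbitrary lists are allowed. *)
Inductive tree := Leaf | Node of tree & tree.

Inductive tlt : tree -> tree -> Prop :=
| tlt_leaf x r : tlt Leaf (Node x r)
| tlt_head x y r s : tlt x y -> tlt (Node x r) (Node y s)
| tlt_tail x r s : tlt r s -> tlt (Node x r) (Node x s).

Definition tle a b := a = b \/ tlt a b.

Lemma tlt_irr a : ~ tlt a a.
Proof. by elim: a => [|x ihx r ihr] h; inversion h; auto. Qed.

Lemma tlt_trans a b c : tlt a b -> tlt b c -> tlt a c.
Proof.
by move=> h; elim: h c => [x r|x y r s xy ih|x r s rs ih] c hc;
  inversion hc; subst; auto using tlt.
Qed.

Lemma tle_refl a : tle a a. Proof. by left. Qed.

Lemma tltW a b : tlt a b -> tle a b. Proof. by right. Qed.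

Lemma tle_lt_trans a b c : tle a b -> tlt b c -> tlt a c.
Proof. by case=> [->//|]; apply: tlt_trans. Qed.

Lemma tlt_le_trans a b c : tlt a b -> tle b c -> tlt a c.
Proof. by move=> h [<-//|]; apply: tlt_trans. Qed.

Lemma tle_trans a b c : tle a b -> tle b c -> tle a c.
Proof. by case=> [->//|h] h'; right; apply: tlt_le_trans h'. Qed.

Lemma tle_or_lt a b : tle a b \/ tlt b a.
Proof.
suff: [\/ tlt a b, a = b | tlt b a].
  by case=> ?; [left; right | left; left | right].
elim: a b => [|x ihx r ihr] [|y s].
- by constructor 2.
- by constructor 1; constructor.
- by constructor 3; constructor.
case: (ihx y) => [h|<-|h]; try by [constructor 1; constructor|constructor 3; constructor].
case: (ihr s) => [h|<-|h]; by [constructor 1; constructor|constructor 2|constructor 3; constructor].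
Qed.

Lemma tle_leaf a : tle Leaf a.
Proof. by case: a => [|x r]; [left | right; constructor]. Qed.

Lemma tmax_exists a b : exists c, [/\ tle a c, tle b c & c = a \/ c = b].
Proof.
case: (tle_or_lt a b) => h; [exists b | exists a]; split; auto using tle_refl, tltW.
Qed.

(** Choosing at finitely many indices goes by induction on the bound, so no choice axiom enters. *)
Lemma finite_choice T (P : nat -> T -> Prop) m :
  (forall i, i <= m -> exists x, P i x) -> exists f, forall i, i <= m -> P i (f i).
Proof.
elim: m => [|m ih] h.
  have [x Px] := h 0 (leqnn 0); exists (fun=> x) => i.
  by rewrite leqn0 => /eqP ->.
have [f Pf] := ih (fun i im => h i (leqW im)).
have [x Px] := h m.+1 (leqnn _).
exists (fun i => if i == m.+1 then x else f i) => i.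
by rewrite leq_eqVlt; case: eqP => [->|_ /=]; last exact: Pf.
Qed.

(* For the ordinal [a] this says that [c] is at most the last exponent of [a]. *)
Fixpoint dominates (a c : tree) : Prop :=
  if a is Node x r then tle c x /\ dominates r c else True.

Lemma dominates_le a c d : tle d c -> dominates a c -> dominates a d.
Proof.
move=> dc; elim: a => //= x _ r ihr [cx /ihr]; split=> //.
exact: tle_trans cx.
Qed.

(* For ordinals, [t = z + omega^c]. *)
Lemma least_dominating z c : exists t,
  [/\ tlt z t, dominates t c,
      forall a, tlt z a -> dominates a c -> tle t a
    & forall a d, tlt c d -> dominates a d -> tlt z a -> tlt t a].
Proof.
(* If [c] is the greatest tree that [t] dominates, the strict clause follows from minimality: an [a]
   that dominates some [d] above [c] cannot equal [t]. *)
suff [t [zt tc tmin tmax]] : exists t, [/\ tlt z t, dominates t c,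
      forall a, tlt z a -> dominates a c -> tle t a
    & forall d, dominates t d -> tle d c].
  exists t; split=> // a d cd ad za.
  case: (tmin a za) => [|ta|//]; first exact: dominates_le (tltW cd) ad.
  by rewrite -ta in ad; case: (tlt_irr (tlt_le_trans cd (tmax d ad))).
elim: z => [|x _ r [t [rt tc tmin tmax]]].
- exists (Node c Leaf); split=> //=.
  + by constructor.
  + by split=> //; left.
  + move=> a h; inversion h => /= -[[->|cx] _]; last by right; constructor.
    by case: (tle_leaf r) => [<-|]; [left | right; constructor].
  + by move=> d [].
(* A head [x] that is at least [c] is kept and the new term goes into the tail; a smaller head gives
   way to the single term omega^c. *)
case: (tle_or_lt c x) => cx.
- exists (Node x t); split=> //=.
  + by constructor.
  + move=> a h; inversion h; subst => /= -[_ sc]; first by right; constructor.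
    by case: (tmin s) => // [<-|]; [left | right; constructor].
  + by move=> d [_ /tmax].
- exists (Node c Leaf); split=> //=.
  + by constructor.
  + by split=> //; left.
  + move=> a h; inversion h; subst => /= -[[->|cy] _];
      try by right; constructor.
      by case: (tle_leaf s) => [<-|]; [left | right; constructor].
    by case: (tle_leaf s) => [<-|]; [left | right; constructor].
  + by move=> d [].
Qed.

(** * Valid sequences and their completion downwards *)

Definition point := nat -> tree.

(** The condition follows Ignatiev's model, except that a component [Leaf] puts no bound on the next
    one. *)
Definition valid (a : point) := forall i, dominates (a i) (a i.+1).

(** The components below [m] are filled in from [m - 1] down to 0, each as the least tree above
    [z i] that dominates the component just chosen. The two final clauses carry a weak and a strict
    comparison at [m] down to all smaller indices: the weak one yields least points of words, the
    strict one the axiom J for diamonds. *)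
Lemma least_below (z b : point) m :
  (forall i, m <= i -> dominates (b i) (b i.+1)) ->
  exists d : point,
    [/\ valid d, forall i, m <= i -> d i = b i,
        forall i, i < m -> tlt (z i) (d i),
        forall a, valid a -> (forall i, i < m -> tlt (z i) (a i)) ->
          tle (b m) (a m) -> forall i, i < m -> tle (d i) (a i)
      & forall a, valid a -> (forall i, i < m -> tlt (z i) (a i)) ->
          tlt (b m) (a m) -> forall i, i < m -> tlt (d i) (a i)].
Proof.
elim: m b => [|m ih] b vb; first by exists b; split=> // i; apply: vb.
have [t [zt tb tmin tlim]] := least_dominating (z m) (b m.+1).
have [|d [vd db zd dmin dlim]] := ih (fun i => if i == m then t else b i).
  move=> i; rewrite leq_eqVlt => /orP [/eqP <-|mi].
    by rewrite eqxx (gtn_eqF (ltnSn m)).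
  by rewrite (gtn_eqF mi) (gtn_eqF (leqW mi : m < i.+1)); apply: vb.
rewrite eqxx in dmin dlim.
have dm : d m = t by rewrite db // eqxx.
exists d; split=> //.
- by move=> i mi; rewrite (db i (ltnW mi)) gtn_eqF.
- by move=> i; rewrite ltnS leq_eqVlt => /orP [/eqP ->|/zd //]; rewrite dm.
- move=> a va za ba.
  have ta := tmin _ (za m (ltnSn m)) (dominates_le ba (va m)).
  move=> i; rewrite ltnS leq_eqVlt => /orP [/eqP ->|im]; first by rewrite dm.
  by apply: (dmin a) => // j jm; apply: za; apply: ltnW.
- move=> a va za ba.
  have ta := tlim _ _ ba (va m) (za m (ltnSn m)).
  move=> i; rewrite ltnS leq_eqVlt => /orP [/eqP ->|im]; first by rewrite dm.
  by apply: (dlim a) => // j jm; apply: za; apply: ltnW.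
Qed.

(** * Satisfaction, soundness and irreflexivity of words *)

Fixpoint sat (e : nat -> point -> Prop) (A : form modality) (a : point) : Prop :=
  match A with
  | Var p => e p a
  | Top => True
  | And A B => sat e A a /\ sat e B a
  | Mod (Dia n) A =>
      exists b, [/\ valid b, sat e A b & forall i, i <= n -> tlt (b i) (a i)]
  | Mod (Nab n) A =>
      exists b, [/\ valid b, sat e A b & forall i, i <= n -> tle (b i) (a i)]
  end.

Definition upward (X : point -> Prop) :=
  forall a b, valid a -> valid b -> (forall i, tle (a i) (b i)) -> X a -> X b.

(** Both J axioms are validated by raising a witness, so variables must denote upward closed
    sets. *)
Lemma sat_upward e A : (forall p, upward (e p)) -> upward (sat e A).
Proof.
move=> he; elim: A => [p||A ihA B ihB|[n|n] A _] a b va vb ab //=.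
- exact: he ab.
- by case=> /ihA hA /ihB hB; split; [apply: hA | apply: hB].
- by case=> c [vc Ac ca]; exists c; split=> // i /ca h; apply: tlt_le_trans h _.
- by case=> c [vc Ac ca]; exists c; split=> // i /ca h; apply: tle_trans h _.
Qed.

Lemma sat_subst e s A a :
  sat e (subst s A) a <-> sat (fun p => sat e (s p)) A a.
Proof.
elim: A a => [p||A ihA B ihB|[n|n] A ih] a //=.
- by split=> -[/ihA ? /ihB ?].
- by split=> -[b [vb /ih Ab ba]]; exists b.
- by split=> -[b [vb /ih Ab ba]]; exists b.
Qed.

(** The induction is uniform in [e], since the substitution rule replaces [e] by the interpretation
    of the substituted formulas. *)
Lemma RCN_sound A B : RCN A B ->
  forall e, (forall p, upward (e p)) ->
  forall a, valid a -> sat e A a -> sat e B a.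
Proof.
elim=> {A B} /=; try by [move=> A B e he a va []|move=> A e he a va].
- move=> A0 B0 [A1 B1 [m n A mn|m n A B mn]|A1 B1 [m n A mn|m n A B mn]
               |n A|n A|m n A mn|m n A mn] e he a va /=.
  + by case=> b [vb Ab ba]; exists b; split=> // i im; apply/ba/(leq_trans im)/ltnW.
  + case=> -[b [vb Ab ba]] [c [vc Bc ca]].
    (* Here [z] is the componentwise maximum of the two witnesses up to [m], still strictly below
       [a]. *)
    have [z hz] : exists z : point, forall i, i <= m ->
        [/\ tle (b i) (z i), tle (c i) (z i) & tlt (z i) (a i)].
      apply: (@finite_choice _ (fun i t =>
        [/\ tle (b i) t, tle (c i) t & tlt t (a i)])) => i im.
      have [t [bt ct tbc]] := tmax_exists (b i) (c i).
      exists t; split=> //; case: tbc => ->; last exact: ca.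
      exact: ba (leq_trans im (ltnW mn)).
    (* The new witness exceeds [z] up to [m] and agrees with [b] beyond. As [m < n], [b] is strictly
       below [a] at [m.+1], which [dlim] propagates down. *)
    have [d [vd db zd _ dlim]] := @least_below z b m.+1 (fun i _ => vb i).
    exists d; split=> //.
      split; last first.
        exists c; split=> // i im; case: (hz i im) => _ cz _.
        exact: tle_lt_trans cz (zd i im).
      apply: sat_upward Ab => // i; case: (leqP i m) => im; last by left; rewrite db.
      by case: (hz i im) => bz _ _; right; apply: tle_lt_trans bz (zd i im).
    move=> i im; case: (leqP i m) => mi; last by rewrite db //; apply: ba.
    by apply: dlim => // [j jm|]; [case: (hz j jm) | apply: ba].
  + by case=> b [vb Ab ba]; exists b; split=> // i im; apply/ba/(leq_trans im)/ltnW.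
  + case=> -[b [vb Ab ba]] [c [vc Bc ca]].
    (* Splicing [a] and [b] stays valid at the joint: [m < n] gives that [b] is at most [a] at
       [m.+1], and [a m] dominates [a m.+1]. *)
    exists (fun i => if i <= m then a i else b i); split.
    * move=> i; case: (ltngtP i m) => im; try exact: va; try exact: vb.
      by apply: dominates_le (va i); apply: ba; rewrite im.
    * split.
        apply: sat_upward Ab => // i; last first.
          case: ifP => im; last exact: tle_refl.
          exact: ba (leq_trans im (ltnW mn)).
        case: (ltngtP i m) => im; try exact: va; try exact: vb.
        by apply: dominates_le (va i); apply: ba; rewrite im.
      by exists c; split=> // i im; rewrite im; apply: ca.
    * by move=> i im; case: ifP => _; [apply: tle_refl | apply: ba].
  + by move=> Aa; exists a; split=> // i _; apply: tle_refl.
  + by case=> b [vb Ab ba]; exists b; split=> // i /ba; apply: tltW.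
  + case=> b [vb [c [vc Ac cb]] ba]; exists c; split=> // i im.
    exact: tle_lt_trans (cb i (leq_trans im mn)) (ba i im).
  + case=> b [vb [c [vc Ac cb]] ba]; exists c; split=> // i im.
    exact: tlt_le_trans (cb i im) (ba i (leq_trans im mn)).
- by move=> A B C _ hAB _ hBC e he a va /hAB h; apply: hBC => //; apply: h.
- by move=> A B C _ hAB _ hAC e he a va Aa; split; [apply: hAB | apply: hAC].
- move=> [n|n] A B _ ih e he a va /= [b [vb Ab ba]]; exists b; split=> //; exact: ih.
- move=> [n|n] A e he a va /= [b [vb [c [vc Ac cb]] ba]]; exists c; split=> // i im.
    exact: tlt_trans (cb i im) (ba i im).
  exact: tle_trans (cb i im) (ba i im).
- move=> s A B _ ih e he a va /sat_subst Aa; apply/sat_subst.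
  by apply: ih Aa => // p; apply: sat_upward.
Qed.

Lemma word_least_point w (e : nat -> point -> Prop) : exists v : point,
  [/\ valid v, sat e (word Dia w) v
    & forall a, valid a -> sat e (word Dia w) a -> forall i, tle (v i) (a i)].
Proof.
elim: w => [|n w [v [vv wv vmin]]] /=.
  by exists (fun=> Leaf); split=> // a _ _ i; apply: tle_leaf.
(* Components beyond [n] are unconstrained by the diamond and take the least value [Leaf], so the
   comparison that [dmin] asks for at [n.+1] is trivial. *)
have [d [vd d0 zd dmin _]] := @least_below v (fun=> Leaf) n.+1 (fun i _ => I).
exists d; split=> //; first by exists v.
move=> a va [b [vb wb ba]] i; case: (leqP i n) => im; last by rewrite d0 //; apply: tle_leaf.
apply: dmin => // [j jn|]; last exact: tle_leaf.
exact: tle_lt_trans (vmin b vb wb j) (ba j jn).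
Qed.

(** At the least point of [w], a witness of the diamond would be a point of [w] with a smaller
    component [i]. *)
Lemma word_irreflexive w i : ~ RCN (word Dia w) (Mod (Dia i) (word Dia w)).
Proof.
move=> /RCN_sound/(_ (fun _ _ => True)) h.
have [v [vv wv vmin]] := word_least_point w (fun _ _ => True).
case: (h _ v vv wv) => // b [vb wb bv].
exact: tlt_irr (tle_lt_trans (vmin b vb wb i) (bv i (leqnn i))).
Qed.

(** * Words in RC *)

Local Notation rcw := (word (@id nat)).

Lemma in_W_le m n w : m <= n -> in_W n w -> in_W m w.
Proof. by move=> mn; apply: sub_all => j; apply: leq_trans. Qed.

Lemma RC_mono m n A : m <= n -> RC (Mod n A) (Mod m A).
Proof.
rewrite leq_eqVlt => /orP [/eqP ->|mn]; first exact: d_refl.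
by apply: d_ax; exact: (@fam_mono _ id).
Qed.

Lemma RC_J m n A B : m < n ->
  RC (And (Mod n A) (Mod m B)) (Mod n (And A (Mod m B))).
Proof. by move=> mn; apply: d_ax; exact: (@fam_J _ id). Qed.

(** Cutting before the first letter [n] isolates a prefix in W_{n+1}; by [RC_word_cat] the word is
    then the conjunction of its two pieces. *)
Lemma word_split n w : in_W n w ->
  exists u r, [/\ w = u ++ r, in_W n.+1 u, in_W n r
                & r = [::] \/ exists v, r = n :: v].
Proof.
elim: w => [|j w ih]; first by exists [::], [::]; split=> //; left.
rewrite /= leq_eqVlt => /andP [/orP [/eqP <-|nj] wn].
  by exists [::], (n :: w); split=> //=; [rewrite leqnn | right; exists w].
have [u [r [-> un rn hr]]] := ih wn; exists (j :: u), r; split=> //=.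
by rewrite nj.
Qed.

(** From right to left, J pushes the formula starting with [n] under the letters of [u] one at a
    time; from left to right, monotonicity and transitivity bring it out. *)
Lemma RC_word_cat_head n u v : in_W n.+1 u ->
  RC_equiv (rcw (u ++ n :: v)) (And (rcw u) (rcw (n :: v))).
Proof.
elim: u => [_|j u ih /= /andP [nj /ih [h1 h2]]].
  by split; [apply: d_and; [apply: d_top | apply: d_refl] | apply: d_andr].
split.
- apply: d_and.
    by apply/d_mod/(d_cut h1)/d_andl.
  apply: d_cut (RC_mono _ (ltnW nj)) _; apply: d_mod_absorb.
  exact: d_cut h1 (d_andr _ _ _).
- by apply: d_cut (RC_J _ _ nj) _; apply: d_mod.
Qed.

Lemma RC_word_cat n u r : in_W n.+1 u -> r = [::] \/ (exists v, r = n :: v) ->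
  RC_equiv (rcw (u ++ r)) (And (rcw u) (rcw r)).
Proof.
move=> un [->|[v ->]]; last exact: RC_word_cat_head.
by rewrite cats0; split; [apply: d_and; [apply: d_refl | apply: d_top] | apply: d_andl].
Qed.

Lemma RC_succ_absorb n A u r : in_W n.+1 u -> r = [::] \/ (exists v, r = n :: v) ->
  RC A (Mod n.+1 (rcw u)) -> RC A (rcw r) -> RC A (Mod n.+1 (rcw (u ++ r))).
Proof.
move=> un hr Au Ar; apply: (d_cut (B := Mod n.+1 (And (rcw u) (rcw r)))); last first.
  by apply: d_mod; apply: (RC_word_cat un hr).2.
case: hr Ar => [-> _|[v -> Ar]].
  by apply: d_cut Au _; apply: d_mod; apply: d_and; [apply: d_refl | apply: d_top].
by apply: d_cut (RC_J _ _ (ltnSn n)); apply: d_and.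
Qed.

Lemma in_W_bounded_nil n w : all (ltn^~ n) w -> in_W n w -> w = [::].
Proof.
case: w => //= j w /andP [jn _] /andP [nj _].
by have := leq_trans jn nj; rewrite ltnn.
Qed.

Lemma letters_bounded n w : exists d, all (ltn^~ (n + d)) w.
Proof.
exists (\max_(j <- w) j).+1; apply/allP => j jw.
by rewrite /= addnS ltnS (leq_trans (leq_bigmax_seq _ jw isT)) // leq_addl.
Qed.

(** Double induction: [k] bounds the total length and [d] the number of levels, the letters lying
    between [n] and [n + d]. Comparing a word with the tail of the other uses the outer hypothesis,
    comparing the two prefixes in W_{n+1} the inner one. *)
Lemma RC_linear_bounded k d n u v : size u + size v < k ->
  all (ltn^~ (n + d)) u -> all (ltn^~ (n + d)) v -> in_W n u -> in_W n v ->
  [\/ RC (rcw u) (Mod n (rcw v)), RC_equiv (rcw u) (rcw v)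
    | RC (rcw v) (Mod n (rcw u))].
Proof.
elim: k d n u v => // k ihk; elim=> [|d ihd] n u v uvk ud vd un vn.
  rewrite addn0 in ud vd; rewrite (in_W_bounded_nil ud un) (in_W_bounded_nil vd vn).
  by constructor 2; split; apply: d_refl.
have [u0 [ru [eu u0n run hru]]] := word_split un.
have [v0 [rv [ev v0n rvn hrv]]] := word_split vn.
(* [r] is shorter than the word that it ends, so [w] can be compared with its tail. *)
have cmp_tail w r : size w + size r < k.+1 -> all (ltn^~ (n + d.+1)) w ->
    all (ltn^~ (n + d.+1)) r -> in_W n w -> in_W n r ->
    r = [::] \/ (exists t, r = n :: t) ->
    RC (rcw w) (rcw r) \/ RC (rcw r) (Mod n (rcw w)).
  move=> szk wd rd wn rn [->|[t rt]]; first by left; apply: d_top.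
  move: szk rd rn; rewrite rt /= addnS ltnS => szk /andP [_ td] /andP [_ tn].
  case: (ihk d.+1 n w t szk wd td wn tn) => h; first by left.
    by right; apply: d_mod; case: h.
  by right; apply: d_mod_absorb.
have [split_u join_u] := RC_word_cat u0n hru.
have [split_v join_v] := RC_word_cat v0n hrv.
move: (ud) (vd) (uvk); rewrite {1 2}eu {1 2}ev !all_cat !size_cat.
move=> /andP [u0d rud] /andP [v0d rvd] uvk'.
case: (cmp_tail u rv) => //.
    by apply: leq_ltn_trans uvk; rewrite ev size_cat leq_add2l leq_addl.
- move=> u_rv.
  case: (cmp_tail v ru) => //.
      by rewrite addnC; apply: leq_ltn_trans uvk; rewrite eu size_cat leq_add2r leq_addl.
    move=> v_ru.
    have shift w : all (ltn^~ (n + d.+1)) w -> all (ltn^~ (n.+1 + d)) w.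
      by rewrite addSnnS.
    have uvk0 : size u0 + size v0 < k.+1.
      by apply: leq_ltn_trans uvk; rewrite eu ev !size_cat leq_add // leq_addr.
    (* Each word now implies the tail of the other, so the prefixes decide; [RC_succ_absorb]
       reattaches a tail under the modality [n.+1]. *)
    case: (ihd n.+1 u0 v0 uvk0 (shift _ u0d) (shift _ v0d) u0n v0n) => h.
    + constructor 1; apply: d_cut (RC_mono _ (leqnSn n)).
      rewrite ev; apply: RC_succ_absorb => //.
      by rewrite eu; apply: d_cut split_u (d_and_l _ h).
    + case: h => h1 h2; constructor 2; rewrite eu ev in u_rv v_ru *; split.
        by apply: d_cut join_v; apply: d_and => //; apply: d_cut split_u (d_and_l _ h1).
      by apply: d_cut join_u; apply: d_and => //; apply: d_cut split_v (d_and_l _ h2).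
    + constructor 3; apply: d_cut (RC_mono _ (leqnSn n)).
      rewrite eu; apply: RC_succ_absorb => //.
      by rewrite ev; apply: d_cut split_v (d_and_l _ h).
  move=> ru_v; constructor 1; rewrite eu; apply: d_cut split_u _.
  exact: d_and_r.
- move=> rv_u; constructor 3; rewrite ev; apply: d_cut split_v _.
  exact: d_and_r.
Qed.

Lemma RC_linear n u v : in_W n u -> in_W n v ->
  [\/ RC (rcw u) (Mod n (rcw v)), RC_equiv (rcw u) (rcw v)
    | RC (rcw v) (Mod n (rcw u))].
Proof.
have [d] := letters_bounded n (u ++ v); rewrite all_cat => /andP [ud vd].
exact: RC_linear_bounded (ltnSn _) ud vd.
Qed.

(** By linearity one of the tails starting with [n] implies the other, the prefixes merge by
    induction one level up, and the results are concatenated. *)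
Lemma RC_word_and n u v : in_W n u -> in_W n v ->
  exists2 w, in_W n w & RC_equiv (And (rcw u) (rcw v)) (rcw w).
Proof.
have [d] := letters_bounded n (u ++ v); rewrite all_cat => /andP [].
elim: d n u v => [|d ihd] n u v ud vd un vn.
  rewrite addn0 in ud vd; rewrite (in_W_bounded_nil ud un) (in_W_bounded_nil vd vn).
  by exists [::] => //; split; [apply: d_andl | apply: d_and; apply: d_refl].
have [u0 [ru [eu u0n run hru]]] := word_split un.
have [v0 [rv [ev v0n rvn hrv]]] := word_split vn.
have [r [rn hr [r1 r2]]] : exists r, [/\ in_W n r, r = [::] \/ (exists t, r = n :: t)
    & RC_equiv (And (rcw ru) (rcw rv)) (rcw r)].
  case: (hru) => [->|[t et]].
    by exists rv; split=> //; split; [apply: d_andr | apply: d_and; [apply: d_top | apply: d_refl]].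
  case: (hrv) => [->|[t' et']].
    by exists ru; split=> //; split; [apply: d_andl | apply: d_and; [apply: d_refl | apply: d_top]].
  have [tn t'n] : in_W n t /\ in_W n t'.
    by move: run rvn; rewrite et et' => /andP [_ ?] /andP [_ ?].
  have hmax x y : RC (rcw x) (Mod n (rcw y)) \/ RC (rcw x) (rcw y) ->
      RC (rcw (n :: x)) (rcw (n :: y)).
    by case=> h; [apply: d_mod_absorb | apply: d_mod].
  have {}hmax : RC (rcw ru) (rcw rv) \/ RC (rcw rv) (rcw ru).
    rewrite et et'; case: (RC_linear tn t'n) => h; [left|left|right]; apply: hmax; auto.
    by right; case: h.
  case: hmax => h; [exists ru | exists rv]; split=> //; split;
    by [apply: d_andl | apply: d_andr | apply: d_and => //; apply: d_refl].
have [||w wn [w1 w2]] := ihd n.+1 u0 v0 _ _ u0n v0n.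
- by move: ud; rewrite eu all_cat addSnnS => /andP [].
- by move: vd; rewrite ev all_cat addSnnS => /andP [].
have [split_u join_u] := RC_word_cat u0n hru.
have [split_v join_v] := RC_word_cat v0n hrv.
have [split_w join_w] := RC_word_cat wn hr.
exists (w ++ r); first by rewrite /in_W all_cat; apply/andP; split; [apply: in_W_le wn|].
rewrite eu ev; split.
- apply: d_cut (d_and_mono split_u split_v) _; apply: d_cut join_w.
  apply: d_and.
    by apply: d_cut w1; apply: d_and_mono; apply: d_andl.
  by apply: d_cut r1; apply: d_and_mono; apply: d_andr.
- apply: d_cut split_w _; apply: d_cut (d_and_mono w2 r2) _; apply: d_and.
    by apply: d_cut join_u; apply: d_and_mono; apply: d_andl.
  by apply: d_cut join_v; apply: d_and_mono; apply: d_andr.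
Qed.

(** * Fat normal forms *)

Local Notation "A |- B" := (RCN A B) (at level 70).
Local Notation dia n := (Mod (Dia n)).
Local Notation nab n := (Mod (Nab n)).
Local Notation wd := (word Dia).

(** * Transfer of the results on words from RC to RC^nabla *)

Fixpoint dia_embed (A : form nat) : form modality :=
  match A with
  | Var p => Var p
  | Top => Top
  | And A B => And (dia_embed A) (dia_embed B)
  | Mod n A => dia n (dia_embed A)
  end.

Lemma dia_embed_subst s A :
  dia_embed (subst s A) = subst (dia_embed \o s) (dia_embed A).
Proof. by elim: A => //= [A -> B ->|n A ->]. Qed.

Lemma dia_embed_word w : dia_embed (rcw w) = wd w.
Proof. by elim: w => //= n w ->. Qed.

Lemma RC_RCN A B : RC A B -> dia_embed A |- dia_embed B.
Proof.
elim=> {A B} [A B [m n {}A mn|m n {}A {}B mn]|A|A|A B|A B|A B C _ h1 _ h2|A B C _ h1 _ h2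
             |n A B _ h|n A|s A B _ h] /=.
- exact/d_ax/RCN_dia/fam_mono.
- exact/d_ax/RCN_dia/fam_J.
- exact: d_refl.
- exact: d_top.
- exact: d_andl.
- exact: d_andr.
- exact: d_cut h1 h2.
- exact: d_and.
- exact: d_mod.
- exact: d_trans.
- by rewrite !dia_embed_subst; apply: d_subst.
Qed.

Lemma RCN_word_cat n u r : in_W n.+1 u -> r = [::] \/ (exists v, r = n :: v) ->
  RCN_equiv (wd (u ++ r)) (And (wd u) (wd r)).
Proof.
move=> un hr; have [/RC_RCN h1 /RC_RCN h2] := RC_word_cat un hr.
by rewrite /= !dia_embed_word in h1 h2.
Qed.

Lemma RCN_linear n u v : in_W n u -> in_W n v ->
  [\/ wd u |- dia n (wd v), RCN_equiv (wd u) (wd v) | wd v |- dia n (wd u)].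
Proof.
move=> un vn; case: (RC_linear un vn) => [/RC_RCN|[/RC_RCN + /RC_RCN]|/RC_RCN];
  rewrite /= !dia_embed_word => h; by [constructor 1|constructor 2|constructor 3].
Qed.

Lemma RCN_word_and n u v : in_W n u -> in_W n v ->
  exists2 w, in_W n w & RCN_equiv (And (wd u) (wd v)) (wd w).
Proof.
move=> un vn; have [w wn [/RC_RCN h1 /RC_RCN h2]] := RC_word_and un vn.
by exists w => //; rewrite /= !dia_embed_word in h1 h2.
Qed.

Lemma RCN_equiv_refl A : RCN_equiv A A.
Proof. by split; apply: d_refl. Qed.

Lemma RCN_equiv_sym A B : RCN_equiv A B -> RCN_equiv B A.
Proof. by case. Qed.

Lemma RCN_equiv_trans A B C : RCN_equiv A B -> RCN_equiv B C -> RCN_equiv A C.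
Proof. by move=> [h1 h2] [h3 h4]; split; [apply: d_cut h1 h3 | apply: d_cut h4 h2]. Qed.

Lemma RCN_equiv_mod a A B : RCN_equiv A B -> RCN_equiv (Mod a A) (Mod a B).
Proof. by case=> h1 h2; split; apply: d_mod. Qed.

Lemma RCN_equiv_and A A' B B' :
  RCN_equiv A A' -> RCN_equiv B B' -> RCN_equiv (And A B) (And A' B').
Proof. by move=> [h1 h2] [h3 h4]; split; apply: d_and_mono. Qed.

(** * Derived laws of nabla *)

Lemma nab_unit n A : A |- nab n A.
Proof. exact/d_ax/RCN_unit. Qed.

Lemma nab_mono m n A : m <= n -> nab n A |- nab m A.
Proof.
rewrite leq_eqVlt => /orP [/eqP ->|mn]; first exact: d_refl.
exact/d_ax/RCN_nab/fam_mono.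
Qed.

Lemma dia_mono m n A : m <= n -> dia n A |- dia m A.
Proof.
rewrite leq_eqVlt => /orP [/eqP ->|mn]; first exact: d_refl.
exact/d_ax/RCN_dia/fam_mono.
Qed.

Lemma dia_nab n A : dia n A |- nab n A.
Proof. exact/d_ax/RCN_dia_nab. Qed.

Lemma nab_absorb m n A B : m <= n -> A |- nab n B -> nab m A |- nab m B.
Proof.
move=> mn h; apply: d_cut (d_trans _ (Nab m) B); apply: d_mod.
exact: d_cut h (nab_mono _ mn).
Qed.

Lemma nab_dia m n A : m <= n -> RCN_equiv (nab n (dia m A)) (dia m A).
Proof. by move=> mn; split; [apply/d_ax/RCN_absorbr | apply: nab_unit]. Qed.

Lemma dia_nab_absorb m n A : m <= n -> RCN_equiv (dia m (nab n A)) (dia m A).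
Proof. by move=> mn; split; [apply/d_ax/RCN_absorbl | apply/d_mod/nab_unit]. Qed.

Lemma nab_and_nab m n A B : m < n ->
  RCN_equiv (nab n (And (nab m A) B)) (And (nab m A) (nab n B)).
Proof.
move=> mn; split.
- apply: d_and; last exact/d_mod/d_andr.
  apply: d_cut (nab_mono _ (ltnW mn)) _; apply: nab_absorb (leqnn m) _.
  exact: d_andl.
- apply: (d_cut (B := And (nab n B) (nab m A))).
    by apply: d_and; [apply: d_andr | apply: d_andl].
  apply: d_cut (d_ax (RCN_nab (fam_J _ _ _ mn))) _; apply: d_mod.
  by apply: d_and; [apply: d_andr | apply: d_andl].
Qed.

Lemma dia_and_nab m n A B : m < n ->
  RCN_equiv (dia n (And (nab m A) B)) (And (dia m A) (dia n B)).
Proof.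
move=> mn; split.
- apply: d_and; last exact/d_mod/d_andr.
  apply: d_cut (dia_mono _ (ltnW mn)) _.
  apply: d_cut (dia_nab_absorb A (leqnn m)).1; exact/d_mod/d_andl.
- apply: (d_cut (B := And (dia n B) (dia m A))).
    by apply: d_and; [apply: d_andr | apply: d_andl].
  apply: d_cut (d_ax (RCN_dia (fam_J _ _ _ mn))) _; apply: d_mod.
  by apply: d_and; [apply: d_and_r; apply: dia_nab | apply: d_andl].
Qed.

Lemma nab_tail n r : r = [::] \/ (exists v, r = n :: v) -> nab n (wd r) |- wd r.
Proof. by case=> [->|[v ->]]; [apply: d_top | apply: (nab_dia _ (leqnn n)).1]. Qed.

(** Let [u0] be the prefix of [u] in W_{n+1} and [r] its tail. If [u0] implies nabla_{n+1} [v], the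
    second conjunct is absorbed and [w] is [u]. Otherwise [v] implies the diamond n+1 of [u0]; then
    [v ++ r] works, J restoring [u] from [u0] and [r]. *)
Lemma nab_and_succ_word n u v : in_W n u -> in_W n.+1 v ->
  exists2 w, in_W n w
    & RCN_equiv (nab n (And (nab n (wd u)) (nab n.+1 (wd v)))) (nab n (wd w)).
Proof.
move=> un vn; have [u0 [r [eu u0n rn hr]]] := word_split un.
have [split_u join_u] := RCN_word_cat u0n hr; rewrite -eu in split_u join_u.
have hle : wd u0 |- nab n.+1 (wd v) \/ wd v |- dia n.+1 (wd u0).
  case: (RCN_linear u0n vn) => [h|[h _]|h]; last by right.
    by left; apply: d_cut h (dia_nab _ _).
  by left; apply: d_cut h (nab_unit _ _).
case: hle => h.
- exists u => //; split.
    by apply: nab_absorb (leqnn n) _; apply: d_andl.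
  apply: d_mod; apply: d_and; first exact: nab_unit.
  by apply: d_cut split_u _; apply: d_and_l.
- have [split_w join_w] := RCN_word_cat vn hr.
  exists (v ++ r); first by rewrite /in_W all_cat; apply/andP; split; [apply: in_W_le vn|].
  split.
  + apply: nab_absorb (leqnSn n) _.
    apply: (d_cut (B := And (nab n (wd r)) (nab n.+1 (wd v)))).
      apply: d_and_mono; last exact: d_refl.
      by apply: d_mod; apply: d_cut split_u _; apply: d_andr.
    apply: d_cut (nab_and_nab _ _ (ltnSn n)).2 _; apply: d_mod.
    apply: d_cut join_w; apply: d_and; first exact: d_andr.
    exact: d_and_l (nab_tail hr).
  + apply: d_mod; apply: d_cut split_w _; apply: d_and; last first.
      by apply: d_and_l; apply: nab_unit.
    have hu : And (wd v) (wd r) |- dia n.+1 (wd u).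
      case: hr join_u => [->|[t ->]] join_u.
        apply: d_and_l; apply: d_cut h _; apply: d_mod; apply: d_cut join_u.
        by apply: d_and; [apply: d_refl | apply: d_top].
      apply: d_cut (d_and_mono h (d_refl _ _)) _.
      apply: d_cut (d_ax (RCN_dia (fam_J _ _ _ (ltnSn n)))) _.
      exact: d_mod.
    apply: d_cut hu _; apply: d_cut (dia_nab _ _) _; exact: nab_mono.
Qed.

(** * Weak normal forms: conjunctions of nablas of words, without fatness *)

(** Equivalence is built into each level, so that closure properties need no syntactic manipulation;
    the words may be T. *)
Inductive weak_nf (n : nat) (F : form modality) : Prop :=
| weak_nf_top : RCN_equiv F Top -> weak_nf n F
| weak_nf_cons w G : in_W n w -> weak_nf n.+1 G ->
    RCN_equiv F (And (nab n (wd w)) G) -> weak_nf n F.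

Lemma weak_nf_equiv n F G : RCN_equiv F G -> weak_nf n F -> weak_nf n G.
Proof.
move=> /RCN_equiv_sym FG; case=> [h|w H wn hH h].
  exact: weak_nf_top (RCN_equiv_trans FG h).
exact: weak_nf_cons wn hH (RCN_equiv_trans FG h).
Qed.

Lemma RCN_top_and A : RCN_equiv (And Top A) A.
Proof. by split; [apply: d_andr | apply: d_and; [apply: d_top | apply: d_refl]]. Qed.

Lemma RCN_and_top A : RCN_equiv (And A Top) A.
Proof. by split; [apply: d_andl | apply: d_and; [apply: d_refl | apply: d_top]]. Qed.

Lemma RCN_nab_top n : RCN_equiv (nab n Top) Top.
Proof. by split; [apply: d_top | apply: nab_unit]. Qed.

Lemma weak_nf_and n F G : weak_nf n F -> weak_nf n G -> weak_nf n (And F G).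
Proof.
move=> hF; elim: hF G => {}n {}F => [eF|w F' wn hF' ih eF] G.
  apply: weak_nf_equiv; apply/RCN_equiv_sym.
  apply: RCN_equiv_trans (RCN_top_and G); apply: RCN_equiv_and => //.
  exact: RCN_equiv_refl.
case=> [eG|v G' vn hG' eG].
  apply: weak_nf_equiv (weak_nf_cons wn hF' eF); apply/RCN_equiv_sym.
  apply: RCN_equiv_trans (RCN_and_top F); apply: RCN_equiv_and => //.
  exact: RCN_equiv_refl.
have [x xn [x1 x2]] : exists2 x, in_W n x &
    RCN_equiv (And (nab n (wd w)) (nab n (wd v))) (nab n (wd x)).
  have hmax x y : wd x |- dia n (wd y) \/ wd x |- wd y -> nab n (wd x) |- nab n (wd y).
    case=> h; last exact: d_mod.
    by apply: nab_absorb (leqnn n) _; apply: d_cut h (dia_nab _ _).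
  have {}hmax : nab n (wd w) |- nab n (wd v) \/ nab n (wd v) |- nab n (wd w).
    case: (RCN_linear wn vn) => h; [left|left|right]; apply: hmax; auto.
    by right; case: h.
  case: hmax => h; [exists w | exists v] => //; split;
    by [apply: d_andl | apply: d_andr | apply: d_and => //; apply: d_refl].
apply: (weak_nf_cons xn (ih _ hG')).
apply: RCN_equiv_trans (RCN_equiv_and eF eG) _; split; apply: d_and.
- by apply: d_cut x1; apply: d_and_mono; apply: d_andl.
- by apply: d_and_mono; apply: d_andr.
- apply: d_and_mono; last exact: d_andl.
  by apply: d_cut x2 (d_andl _ _ _).
- apply: d_and_mono; last exact: d_andr.
  by apply: d_cut x2 (d_andr _ _ _).
Qed.

(** The outer nabla allows nabla_{n+1} to be put in front of the remaining conjuncts, which then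
    collapse to one word by induction; [nab_and_succ_word] merges it with the first. *)
Lemma weak_nf_nab_word n F : weak_nf n F ->
  exists2 w, in_W n w & RCN_equiv (nab n F) (nab n (wd w)).
Proof.
elim=> {}n {}F => [eF|u G un _ [v vn eG] eF].
  by exists [::] => //; apply: RCN_equiv_mod.
have [w wn ew] := nab_and_succ_word un vn; exists w => //.
apply: RCN_equiv_trans ew.
apply: RCN_equiv_trans (RCN_equiv_mod _ eF) _.
apply: (@RCN_equiv_trans _ (nab n (And (nab n (wd u)) (nab n.+1 G)))).
  split; first by apply: d_mod; apply: d_and_mono; [apply: d_refl | apply: nab_unit].
  apply: nab_absorb (leqnSn n) _; exact: (nab_and_nab _ _ (ltnSn n)).2.
by apply/RCN_equiv_mod/RCN_equiv_and => //; apply: RCN_equiv_refl.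
Qed.

Lemma weak_nf_nab n j F : n <= j -> weak_nf n F -> weak_nf n (nab j F).
Proof.
move=> nj hF; elim: hF nj => {}n {}F => [eF _|u G un hG ih eF nj].
  by apply: weak_nf_top; apply: RCN_equiv_trans (RCN_nab_top j); apply: RCN_equiv_mod.
move: nj; rewrite leq_eqVlt => /orP [/eqP <-|nj].
  have [w wn ew] := weak_nf_nab_word (weak_nf_cons un hG eF).
  apply: (weak_nf_cons wn (weak_nf_top _ (RCN_equiv_refl Top))).
  exact: RCN_equiv_trans ew (RCN_equiv_sym (RCN_and_top _)).
apply: (weak_nf_cons un (ih nj)).
by apply: RCN_equiv_trans (RCN_equiv_mod _ eF) _; apply: nab_and_nab.
Qed.

(** For [j = n] the diamond absorbs a nabla_n, under which [F] is a word. For larger [j] the first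
    conjunct leaves as a diamond [n] by [dia_and_nab], and two words are conjoined. *)
Lemma weak_nf_dia_word n j F : n <= j -> weak_nf n F ->
  exists2 w, in_W n w & RCN_equiv (dia j F) (wd w).
Proof.
move=> nj hF; elim: hF nj => {}n {}F => [eF nj|u G un hG ih eF nj].
  by exists [:: j]; [rewrite /= nj | apply: RCN_equiv_mod].
move: nj; rewrite leq_eqVlt => /orP [/eqP <-|nj].
  have [w wn ew] := weak_nf_nab_word (weak_nf_cons un hG eF).
  exists (n :: w); first by rewrite /= leqnn.
  apply: RCN_equiv_trans (RCN_equiv_sym (dia_nab_absorb _ (leqnn n))) _.
  apply: RCN_equiv_trans (RCN_equiv_mod _ ew) _; exact: dia_nab_absorb.
have [w wn ew] := ih nj.
have [|x xn ex] := RCN_word_and (u := n :: u) _ (in_W_le (leqnSn n) wn).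
  by rewrite /= leqnn.
exists x => //; apply: RCN_equiv_trans ex.
apply: RCN_equiv_trans (RCN_equiv_mod _ eF) _.
apply: RCN_equiv_trans (dia_and_nab _ _ nj) _.
by apply: RCN_equiv_and => //; apply: RCN_equiv_refl.
Qed.

Lemma weak_nf_word n w : in_W n w -> weak_nf n (wd w).
Proof.
have [d] := letters_bounded n w.
elim: d n w => [|d ih] n w wd wn.
  by rewrite addn0 in wd; rewrite (in_W_bounded_nil wd wn); apply/weak_nf_top/RCN_equiv_refl.
have [u [r [ew un rn hr]]] := word_split wn.
apply: (weak_nf_cons rn (ih _ _ _ un)).
  by move: wd; rewrite ew all_cat addSnnS => /andP [].
rewrite ew; have [split_w join_w] := RCN_word_cat un hr; split.
  by apply: d_cut split_w _; apply: d_and; [apply: d_and_r; apply: nab_unit | apply: d_andl].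
apply: d_cut join_w; apply: d_and; first exact: d_andr.
exact: d_and_l (nab_tail hr).
Qed.

Lemma in_F_weak_nf n F : in_F n F -> weak_nf n F.
Proof.
elim: F => //= [_|F ihF G ihG /andP [/ihF hF /ihG hG]|[j|j] F ih /andP [nj /ih hF]].
- exact/weak_nf_top/RCN_equiv_refl.
- exact: weak_nf_and.
- have [w wn /RCN_equiv_sym ew] := weak_nf_dia_word nj hF.
  exact: weak_nf_equiv ew (weak_nf_word wn).
- exact: weak_nf_nab.
Qed.

(** * From weak to fat normal forms *)

Lemma eq_nabla_conj n k (A B : nat -> seq nat) :
  (forall i, n <= i <= n + k -> A i = B i) -> nabla_conj n k A = nabla_conj n k B.
Proof.
elim: k n => [|k ih] n h /=; first by rewrite h // addn0 leqnn.
rewrite (h n) ?leqnn ?leq_addr // (ih n.+1) // => i /andP [ni ik].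
by apply: h; rewrite (ltnW ni) -addSnnS.
Qed.

Lemma weak_nf_conj n F : weak_nf n F -> RCN_equiv F Top \/
  exists k A, [/\ RCN_equiv F (nabla_conj n k A), A (n + k) <> [::]
                & forall i, n <= i <= n + k -> in_W i (A i)].
Proof.
elim=> {}n {}F => [|w G wn _ ih eF]; first by left.
case: ih => [eG|[k [A [eG nt AW]]]].
  have {eG}eF : RCN_equiv F (nab n (wd w)).
    apply: RCN_equiv_trans (RCN_and_top _); apply: RCN_equiv_trans eF _.
    by apply: RCN_equiv_and => //; apply: RCN_equiv_refl.
  (* A trailing empty word is dropped, which keeps the last word of the conjunction nonempty. *)
  case: w wn eF => [_ eF|j w wn eF]; first by left; apply: RCN_equiv_trans eF (RCN_nab_top n).
  right; exists 0, (fun=> j :: w); split=> // i; rewrite addn0 -eqn_leq => /eqP <- //.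
right; exists k.+1, (fun i => if i == n then w else A i); split.
- apply: RCN_equiv_trans eF _; rewrite /= eqxx; apply: RCN_equiv_and; first exact: RCN_equiv_refl.
  rewrite (@eq_nabla_conj n.+1 k _ A) // => i /andP [ni _].
  by rewrite gtn_eqF.
- by rewrite -addSnnS gtn_eqF // ltn_addr.
- move=> i /andP [ni ik]; case: eqP => [->//|/eqP ne].
  by apply: AW; rewrite addSnnS ik ltn_neqAle eq_sym ne ni.
Qed.

Lemma in_F_nabla_conj n i k (A : nat -> seq nat) : n <= i ->
  (forall j, i <= j <= i + k -> in_W j (A j)) -> in_F n (nabla_conj i k A).
Proof.
have in_F_nab j : n <= j -> in_W j (A j) -> in_F n (nab j (wd (A j))).
  move=> nj Aj; rewrite /= nj /=; have := in_W_le nj Aj.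
  by elim: (A j) => //= x w ih /andP [-> /ih].
elim: k i => [|k ih] i ni AW; first by apply: in_F_nab (AW i _) => //; rewrite addn0 leqnn.
apply/andP; split; first by apply: in_F_nab (AW i _) => //; rewrite leqnn leq_addr.
apply: ih (leqW ni) _ => j /andP [ij jk]; apply: AW.
by rewrite (ltnW ij) -addSnnS.
Qed.

Lemma nabla_conj_and n k A (F : form modality) :
  (forall i, n <= i <= n + k -> F |- nab i (wd (A i))) -> F |- nabla_conj n k A.
Proof.
elim: k n => [|k ih] n h; first by apply: h; rewrite addn0 leqnn.
apply: d_and; first by apply: h; rewrite leqnn leq_addr.
by apply: ih => i /andP [ni ik]; apply: h; rewrite (ltnW ni) -addSnnS.
Qed.

Lemma nabla_conj_tail n k A i : n <= i <= n + k ->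
  nabla_conj n k A |- nabla_conj i (n + k - i) A.
Proof.
elim: k n => [|k ih] n.
  by rewrite addn0 -eqn_leq => /eqP <-; rewrite subnn; apply: d_refl.
rewrite leq_eqVlt => /andP [/orP [/eqP <-|ni] ik].
  by rewrite addKn; apply: d_refl.
by apply: d_and_r; rewrite -addSnnS; apply: ih; rewrite ni addSnnS.
Qed.

Lemma nabla_conj_head n k A : nabla_conj n k A |- nab n (wd (A n)).
Proof. by case: k => [|k]; [apply: d_refl | apply: d_andl]. Qed.

Lemma nabla_conj_proj n k A i : n <= i <= n + k ->
  nabla_conj n k A |- nab i (wd (A i)).
Proof. by move=> h; apply: d_cut (nabla_conj_tail A h) (nabla_conj_head _ _ _). Qed.

Lemma weak_nf_nabla_conj n k (A : nat -> seq nat) :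
  (forall i, n <= i <= n + k -> in_W i (A i)) -> weak_nf n (nabla_conj n k A).
Proof. by move=> AW; apply/in_F_weak_nf/in_F_nabla_conj. Qed.

Lemma fatten n k (A : nat -> seq nat) :
  (forall i, n <= i <= n + k -> in_W i (A i)) -> A (n + k) <> [::] ->
  exists2 B, fat_conditions n k B & RCN_equiv (nabla_conj n k A) (nabla_conj n k B).
Proof.
move=> AW nt.
(* At the last index [A] is kept literally, so that the last word stays nonempty; below [n] the
   value is an arbitrary default. *)
have [|B hB] := @finite_choice _ (fun i w => n <= i ->
    [/\ in_W i w, i = n + k -> w = A i
      & RCN_equiv (nab i (nabla_conj i (n + k - i) A)) (nab i (wd w))]) (n + k).
  move=> i ik; case: (leqP n i) => [ni|]; last by exists [::].
  case: (eqVneq i (n + k)) => [->|ne].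
    exists (A (n + k)) => _; rewrite subnn /=; split=> //.
      by apply: AW; rewrite leq_addr leqnn.
    by split; [apply: d_trans | apply: nab_unit].
  have [|w wi ew] := @weak_nf_nab_word i (nabla_conj i (n + k - i) A).
    apply: weak_nf_nabla_conj => j /andP [ij]; rewrite subnKC // => jk.
    by apply: AW; rewrite jk (leq_trans ni).
  by exists w => _; split=> // /eqP; rewrite (negbTE ne).
have {}hB i : n <= i <= n + k -> [/\ in_W i (B i), i = n + k -> B i = A i
      & RCN_equiv (nab i (nabla_conj i (n + k - i) A)) (nab i (wd (B i)))].
  by case/andP => ni ik; apply: hB.
have tail i : n <= i <= n + k ->
    nabla_conj i (n + k - i) A |- nabla_conj i (n + k - i) B.
  case/andP => ni ik; apply: nabla_conj_and => j /andP [ij]; rewrite subnKC // => jk.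
  case: (hB j) => [|_ _ [h _]]; first by rewrite jk (leq_trans ni).
  apply: (d_cut (B := nabla_conj j (n + k - j) A)); last exact: d_cut (nab_unit _ _) h.
  have := @nabla_conj_tail i (n + k - i) A j; rewrite subnKC //; apply.
  by rewrite ij.
exists B; first split.
- by move=> i /hB [].
- by case: (hB (n + k)) => [|_ -> //]; rewrite leq_addr leqnn.
- move=> i hi; case: (hB i hi) => _ _ [_ h]; apply: d_cut h _.
  exact/d_mod/tail.
split.
  by have := tail n; rewrite leqnn leq_addr addKn; apply.
apply: nabla_conj_and => i hi; apply: d_cut (nabla_conj_proj B hi) _.
case: (hB i hi) => _ _ [_ h]; apply: d_cut h _.
by apply: nab_absorb (leqnn i) _; apply: nabla_conj_head.
Qed.

Lemma fat_normal_form_exists n F : in_F n F ->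
  exists2 G, fat_normal_form n G & RCN_equiv F G.
Proof.
move=> /in_F_weak_nf/weak_nf_conj [eF|[k [A [eF nt AW]]]].
  by exists Top => //; split=> //; left.
have [B fB eB] := fatten AW nt.
exists (nabla_conj n k B); last exact: RCN_equiv_trans eF eB.
by split; [apply: in_F_nabla_conj; case: fB | right; exists k, B].
Qed.

(** * Uniqueness *)

Fixpoint erase (i : nat) (A : form modality) : form modality :=
  match A with
  | Var p => Var p
  | Top => Top
  | And A B => And (erase i A) (erase i B)
  | Mod a A => if i <= modality_index a then Mod a (erase i A) else Top
  end.

Lemma erase_subst i s A : erase i (subst s A) = subst (erase i \o s) (erase i A).
Proof. by elim: A => //= [A -> B ->|a A ->] //; case: ifP. Qed.

(** The only mixed case is J with [m < i <= n]: its second conjunct is erased and the axiom becomes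
    trivial. *)
Lemma RCN_erase_family i f A B :
  (forall j, modality_index (f j) = j) ->
  (forall A B, family_ax f A B -> RCN_ax A B) ->
  family_ax f A B -> erase i A |- erase i B.
Proof.
move=> fi fRCN [m n {}A mn|m n {}A {}B mn] /=; rewrite !fi.
  case: (leqP i m) => im; last exact: d_top.
  by rewrite (leq_trans im (ltnW mn)); apply/d_ax/fRCN/fam_mono.
case: (leqP i n) => i_n; last exact: d_top.
case: (leqP i m) => im; first exact/d_ax/fRCN/fam_J.
by apply: d_and_l; apply: d_mod; apply: d_and; [apply: d_refl | apply: d_top].
Qed.

Lemma RCN_erase i A B : A |- B -> erase i A |- erase i B.
Proof.
elim=> {A B} [A0 B0 []|A|A|A B|A B|A B C _ h1 _ h2|A B C _ h1 _ h2
             |a A B _ h|a A|s A B _ h] /=; rewrite -/(RCN _ _).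
- by move=> A B; apply: RCN_erase_family => // {}A {}B; apply: RCN_dia.
- by move=> A B; apply: RCN_erase_family => // {}A {}B; apply: RCN_nab.
- move=> n A; case: ifP => _; [apply: nab_unit | apply: d_top].
- move=> n A; case: ifP => _; [apply: dia_nab | apply: d_top].
- move=> m n A mn; case: ifP => im; last exact: d_top.
  by rewrite (leq_trans im mn); apply: (dia_nab_absorb _ mn).1.
- move=> m n A mn; case: (leqP i m) => im; last by case: ifP => _; apply: d_top.
  by rewrite (leq_trans im mn); apply: (nab_dia _ mn).1.
- exact: d_refl.
- exact: d_top.
- exact: d_andl.
- exact: d_andr.
- exact: d_cut h1 h2.
- exact: d_and.
- by case: ifP => _; [apply: d_mod | apply: d_top].
- by case: ifP => ia; rewrite /= ?ia; [apply: d_trans | apply: d_top].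
- by rewrite !erase_subst; apply: d_subst.
Qed.

Lemma erase_in_F i A : in_F i A -> erase i A = A.
Proof.
by elim: A => //= [A ihA B ihB /andP [/ihA -> /ihB ->]|a A ih /andP [-> /ih ->]].
Qed.

Lemma erase_nabla_conj n k A i : n <= i <= n + k ->
  (forall j, n <= j <= n + k -> in_W j (A j)) ->
  nabla_conj i (n + k - i) A |- erase i (nabla_conj n k A).
Proof.
elim: k n => [|k ih] n hi AW.
  move: hi; rewrite addn0 -eqn_leq => /eqP ni.
  by rewrite -ni subnn erase_in_F; [apply: d_refl | apply: in_F_nabla_conj].
move: (hi); rewrite leq_eqVlt => /andP [/orP [/eqP <-|ni] ik].
  by rewrite addKn erase_in_F; [apply: d_refl | apply: in_F_nabla_conj].
rewrite /= leqNgt ni /=; apply: d_and; first exact: d_top.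
rewrite -addSnnS; apply: ih; first by rewrite ni addSnnS.
by move=> j /andP [nj jk]; apply: AW; rewrite (ltnW nj) -addSnnS.
Qed.

Lemma erase_nabla_conj_top n k A i : n + k < i ->
  Top |- erase i (nabla_conj n k A).
Proof.
elim: k n => [|k ih] n ni /=.
  by rewrite leqNgt -(addn0 n) ni; apply: d_refl.
rewrite leqNgt (leq_ltn_trans (leq_addr _ _) ni) /=.
by apply: d_and; [apply: d_refl | apply: ih; rewrite addSnnS].
Qed.

Lemma word_inj M (f : nat -> M) : injective f -> injective (word f).
Proof.
by move=> finj; elim=> [|i u ih] [|j v] //= [/finj -> /ih ->].
Qed.

Lemma nabla_conj_inj n k m A B : nabla_conj n k A = nabla_conj n m B ->
  k = m /\ forall i, n <= i <= n + k -> A i = B i.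
Proof.
have Dinj : injective Dia by move=> i j [].
elim: k n m => [|k ih] n [|m] //=.
  by move=> [/(word_inj Dinj) e]; split=> // i; rewrite addn0 -eqn_leq => /eqP <-.
move=> [/(word_inj Dinj) e] /ih [-> h]; split=> // i.
rewrite leq_eqVlt -addSnnS => /andP [/orP [/eqP <- //|ni] ik].
by apply: h; rewrite ni.
Qed.

(** [fat_normal_form] only asserts that some words present the formula; injectivity of the encoding
    identifies them with those of [A] at the indices in range. *)
Lemma fat_nabla_conj n k A :
  fat_normal_form n (nabla_conj n k A) -> fat_conditions n k A.
Proof.
case=> _ [|[k' [B [/nabla_conj_inj [<- AB] [BW nt fat]]]]]; first by case: k.
split.
- by move=> i hi; rewrite AB //; apply: BW.
- by rewrite AB // leq_addr leqnn.
- move=> i hi; rewrite AB // (@eq_nabla_conj i _ A B); first exact: fat.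
  case/andP: hi => ni ik j /andP [ij]; rewrite subnKC // => jk.
  by apply: AB; rewrite jk (leq_trans ni).
Qed.

(** Fatness of [A] recovers its conjuncts from [i] on under nabla_i; these imply the erased
    conjunction of [A], hence that of [B], whose conjunct at [i] survives erasure unchanged. *)
Lemma fat_nab_le n k m A B i :
  fat_conditions n k A -> fat_conditions n m B ->
  nabla_conj n k A |- nabla_conj n m B ->
  n <= i <= n + m -> i <= n + k -> nab i (wd (A i)) |- nab i (wd (B i)).
Proof.
move=> [AW _ fatA] [BW _ _] AB him ik.
have hik : n <= i <= n + k by case/andP: him => ->.
apply: d_cut (fatA i hik) _; apply: nab_absorb (leqnn i) _.
apply: d_cut (erase_nabla_conj hik AW) _.
apply: d_cut (RCN_erase i AB) _.
have -> : nab i (wd (B i)) = erase i (nab i (wd (B i))).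
  rewrite erase_in_F //; have := @in_F_nabla_conj i i 0 B (leqnn i); apply=> j.
  by rewrite addn0 -eqn_leq => /eqP <-; apply: BW.
exact/RCN_erase/nabla_conj_proj.
Qed.

(** Were [k < m], erasing below [n + m] would trivialize the conjunction of [A], so T would imply
    nabla of a nonempty word of W_{n+m}, hence the diamond [n + m] of T, against irreflexivity for
    the empty word. *)
Lemma fat_length_le n k m A B :
  fat_conditions n m B ->
  nabla_conj n k A |- nabla_conj n m B -> m <= k.
Proof.
move=> [BW nt _] AB; rewrite leqNgt -(ltn_add2l n); apply/negP => km.
have him : n <= n + m <= n + m by rewrite leq_addr leqnn.
apply: (@word_irreflexive [::] (n + m)) => /=.
apply: d_cut (erase_nabla_conj_top A km) _.
apply: d_cut (RCN_erase _ (d_cut AB (nabla_conj_proj B him))) _.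
move: nt (BW _ him); case: (B (n + m)) => //= j w _ /andP [mj _].
rewrite leqnn mj; apply: d_cut (d_mod _ (dia_mono _ mj)) _.
apply: d_cut (nab_dia _ (leqnn _)).1 _; exact/d_mod/d_top.
Qed.

(** By linearity it suffices to exclude a strict comparison. If [y] implied the diamond [i] of [x],
    then [x] would imply nabla_i of that diamond, which collapses to the diamond itself. *)
Lemma nab_word_inj i u v : in_W i u -> in_W i v ->
  RCN_equiv (nab i (wd u)) (nab i (wd v)) -> RC_equiv (rcw u) (rcw v).
Proof.
move=> ui vi [uv vu].
have absurd x y : nab i (wd x) |- nab i (wd y) -> ~ RC (rcw y) (Mod i (rcw x)).
  move=> xy /RC_RCN; rewrite /= !dia_embed_word => yx.
  apply: (@word_irreflexive x i); apply: d_cut (nab_unit i _) _; apply: d_cut xy _.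
  by apply: d_cut (d_mod _ yx) _; apply: (nab_dia _ (leqnn i)).1.
by case: (RC_linear ui vi) => [/(absurd _ _ vu)||/(absurd _ _ uv)].
Qed.

Theorem theorem4 (n : nat) :
  (forall A : form modality, in_F n A ->
     exists2 B : form modality, fat_normal_form n B & RCN_equiv A B) /\
  (forall (A : form modality) (k m : nat) (U V : nat -> seq nat),
     in_F n A ->
     fat_normal_form n (nabla_conj n k U) ->
     fat_normal_form n (nabla_conj n m V) ->
     RCN_equiv (nabla_conj n k U) A ->
     RCN_equiv (nabla_conj n m V) A ->
     k = m /\
     forall i : nat, n <= i <= n + k ->
       RC_equiv (word id (U i)) (word id (V i))).
Proof.
split; first exact: fat_normal_form_exists.
move=> A k m U V _ /fat_nabla_conj fU /fat_nabla_conj fV eU eV.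
have [UV VU] := RCN_equiv_trans eU (RCN_equiv_sym eV).
have km : k = m.
  by apply/eqP; rewrite eqn_leq (fat_length_le fU VU) (fat_length_le fV UV).
subst m; split=> // i hi; have /andP [_ ik] := hi.
apply: (@nab_word_inj i); [by case: fU => + _ _; apply | by case: fV => + _ _; apply |].
by split; [apply: fat_nab_le UV hi ik | apply: fat_nab_le VU hi ik].
Qed.
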